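(* Let $m$ and $s$ be positive integers with $s<m$. Let $n>1$ be an odd integer with $n\equiv 1\pmod m$ or $n\equiv -1\pmod m$. Then, for every integer $r\ge 2$, $$\sum_{k=0}^{n^r-1}\frac{2(q^s;q^m)_k(q^{m-s};q^m)_k\,q^{mk}}{(q^m;q^m)_k^2(1+q^{mk})}\equiv(-1)^{\langle -s/m\rangle_n}\sum_{k=0}^{n^{r-1}-1}\frac{2(q^{sn};q^{mn})_k(q^{mn-sn};q^{mn})_k\,q^{mnk}}{(q^{mn};q^{mn})_k^2(1+q^{mnk})}\pmod{\prod_{j=1}^r\Phi_{n^j}(q)^2}.$$
   Context: Here $q$ is an indeterminate. The $q$-shifted factorial is $(x;q)_0=1$ and $(x;q)_k=(1-x)(1-xq)\cdots(1-xq^{k-1})$ for $k\ge 1$ (so, e.g., $(x;q^m)_k=\prod_{i=0}^{k-1}(1-xq^{mi})$), and $(x;q)_k^2$ means $((x;q)_k)^2$. $\Phi_N(q)=\prod_{1\le k\le N,\ \gcd(N,k)=1}(q-e^{2\pi\sqrt{-1}\,k/N})$ is the $N$-th cyclotomic polynomial. For a rational number $x$ whose denominator is coprime to $n$, $\langle x\rangle_n$ denotes the least nonnegative residue of $x$ modulo $n$, i.e. the unique integer in $\{0,1,\dots,n-1\}$ congruent to $x$ modulo $n$ (here $\gcd(m,n)=1$, so $\langle -s/m\rangle_n$ is the unique $t\in\{0,\dots,n-1\}$ with $mt\equiv -s\pmod n$). Congruences of rational functions: for polynomials $A_1(q),A_2(q),P(q)\in\mathbb{Z}[q]$, $A_1(q)/A_2(q)\equiv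 0\pmod{P(q)}$ means that $P(q)$ divides $A_1(q)$ and is relatively prime to $A_2(q)$; more generally, for rational functions $B(q),C(q)$, $B(q)\equiv C(q)\pmod{P(q)}$ means that the numerator of the reduced form (lowest terms) of $B(q)-C(q)$ is divisible by $P(q)$. *)

(* Defs.v *)
From mathcomp Require Import all_boot all_order all_algebra all_field.

Set Implicit Arguments.
Unset Strict Implicit.
Unset Printing Implicit Defensive.

Import Order.TTheory GRing.Theory Num.Theory.
Local Open Scope ring_scope.

(* Every rational function with rational coefficients is a quotient of two
   elements of Z[q], so Q(q) is taken to be the fraction field of Z[q]. *)
Definition ratfun := {fraction {poly int}}.

Definition q : ratfun := tofrac 'X.

Definition qfact (R : pzRingType) (x p : R) (k : nat) : R :=
  \prod_(0 <= i < k) (1 - x * p ^+ i).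

(* Divisibility in Z[q] itself: the library's [%|] on {poly int} is
   pseudo-divisibility, i.e. divisibility in Q[q]. *)
Definition zpdvd (A B : {poly int}) : Prop := exists U : {poly int}, B = A * U.

(* No nontrivial common factor in Z[q], integer constants included; [coprimep]
   on {poly int} would ignore the latter. *)
Definition zpcoprime (A B : {poly int}) : Prop :=
  forall D : {poly int}, zpdvd D A -> zpdvd D B -> D \is a GRing.unit.

(* The numerator of the reduced form A1 / A2 of B - C is divisible by P.  The
   reduced form is unique up to a common sign, so [exists] is unambiguous. *)
Definition rf_congr (B C : ratfun) (P : {poly int}) : Prop :=
  exists A1 A2 : {poly int},
    [/\ A2 != 0, zpcoprime A1 A2, B - C = tofrac A1 / tofrac A2 & zpdvd P A1].

(* The t in {0, ..., n-1} congruent to x modulo n, for x : rat with denominator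
   coprime to n: such an x is congruent to t iff n divides the numerator of
   x - t in lowest terms.  If there is no such t the value is n. *)
Definition least_residue (x : rat) (n : nat) : nat :=
  find (fun t : nat => (n%:Z %| numq (x - t%:R))%Z) (iota 0 n).

(* Main.v *)
Require Import Defs.
From mathcomp Require Import all_boot all_order all_algebra all_field.
From mathcomp Require Import zify ring.

Set Implicit Arguments.
Unset Strict Implicit.
Unset Printing Implicit Defensive.

Import Order.TTheory GRing.Theory Num.Theory.
Local Open Scope ring_scope.

(** Put [p = q^m] and let [S_K(p, A)] be the sum over [k < K] of
    [2 (A;p)_k (p/A;p)_k p^k / ((p;p)_k^2 (1 + p^k))], a truncated balanced
    3phi2 series.  Both sides of the congruence are such sums, with [A = q^s]
    on the left.  The idea is to treat [A] as a free parameter.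

    For [A = p^(-N)] or [A = p^(N+1)] with [N < K] the sum terminates, and
    its value is [(-1)^N].  This is a case of the q-Saalschuetz formula; here
    it comes from the two-term relation [phi_sum_contiguous], whose right-hand
    side vanishes at these points.

    Choose [s'] to be [s] or [m - s] according to the sign in
    [n = +-1 (mod m)], so that [n s' = s + m t] with [0 <= t < n]; then [t] is
    the least residue of [-s/m], and up to the symmetry [A <-> p/A] the
    right-hand sum is [S(p^n, A p^t)] at [A = q^s].  With [M = n^(r-1)] consider
    [S_(nM)(p, A) - (-1)^t S_M(p^n, A p^t)].  At the [2M] points
    [A = p^(nl - t)], [-M < l <= M], both sums terminate and their values agree,
    because [n] is odd.  After clearing denominators the difference is a
    polynomial in [A] over Z[q], so it is divisible by the product of the [2M]
    corresponding linear factors ([gap_factorization]).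

    At [A = q^s] these factors are, up to powers of [q] and signs, the
    [q^(n(s' + mi)) - 1] and the [q^(n(m - s' + mi)) - 1] with [i < M].  As
    [m] and [n] are coprime, [Phi_(n^j)] occurs in them exactly [2 n^(r-j)]
    times.  The cleared denominator is [(p;p)_(nM-1)^2] times factors
    [1 + p^i] prime to every [Phi_(n^j)], and contains [Phi_(n^j)] exactly
    [2 n^(r-j) - 2] times.  What is left is the factor [Phi_(n^j)^2] for each
    [j] ([difference_quotient]). *)

Local Notation "x %:F" := (tofrac x) : ring_scope.
Local Notation pZtoC := (map_poly (intr : int -> algC)).

(** * Terminating values of a balanced 3phi2 series *)

(** The truncation of the 3phi2 series with upper parameters [A], [p / A],
    [-1], lower parameters [p], [-p] and argument [p]: the quotient
    [(-1;p)_k / (-p;p)_k] is [2 / (1 + p^k)]. *)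
Definition phi_sum (F : fieldType) (p : F) (K : nat) (A : F) : F :=
  \sum_(0 <= k < K)
    2%:R * qfact A p k * qfact (p / A) p k * p ^+ k
      / (qfact p p k ^+ 2 * (1 + p ^+ k)).

Lemma qfactS (R : pzRingType) (x p : R) k :
  qfact x p k.+1 = qfact x p k * (1 - x * p ^+ k).
Proof. by rewrite /qfact big_nat_recr. Qed.

Lemma qfactSl (R : comPzRingType) (x p : R) k :
  qfact x p k.+1 = (1 - x) * qfact (p * x) p k.
Proof.
rewrite /qfact big_nat_recl // expr0 mulr1; congr (_ * _).
by apply: eq_bigr => i _; rewrite exprS mulrCA !mulrA.
Qed.

Lemma qfact_eq0 (F : fieldType) (x p : F) k i :
  (i < k)%N -> x * p ^+ i = 1 -> qfact x p k = 0.
Proof.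
move=> ik xpi; rewrite /qfact big_mkord (bigD1 (Ordinal ik)) //=.
by rewrite xpi subrr mul0r.
Qed.

Lemma phi_sumC (F : fieldType) (p A : F) K :
  p != 0 -> A != 0 -> phi_sum p K (p / A) = phi_sum p K A.
Proof.
move=> p0 A0; apply: eq_bigr => k _.
have -> : p / (p / A) = A by field; rewrite A0 p0.
by congr (_ * _ / _); rewrite mulrAC.
Qed.

Section ThreePhiTwo.
Variables (F : fieldType) (p : F).
Hypothesis p_neq0 : p != 0.
Hypothesis pX_neq1 : forall k, (0 < k)%N -> p ^+ k != 1.
Hypothesis pX_neqN1 : forall k, p ^+ k != -1.

Let den1_neq0 k : 1 + p ^+ k != 0.
Proof. by rewrite addrC -[1]opprK subr_eq0. Qed.

Lemma qfact_neq0 k : qfact p p k != 0.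
Proof.
rewrite /qfact prodf_seq_neq0; apply/allP => i _ /=.
by rewrite -exprS subr_eq0 eq_sym pX_neq1.
Qed.

(** The factor [1 + p^k] of the denominator cancels when the [k]-th terms of
    the two sums are added: the sum of the terms is
    [2 (u;p)_k (1/u;p)_k p^k / (p;p)_k^2], and this telescopes. *)
Lemma phi_sum_contiguous u K : u != 0 ->
  phi_sum p K.+1 u^-1 + phi_sum p K.+1 (p / u)
  = 2%:R * qfact (p * u) p K * qfact (p / u) p K / qfact p p K ^+ 2.
Proof.
move=> u0; elim: K => [|K IH].
  rewrite /phi_sum !big_nat1 /qfact !big_nil.
  have := den1_neq0 0; rewrite expr0 => h2.
  by field; rewrite h2 oner_neq0.
rewrite {1 2}/phi_sum big_nat_recr //= [X in _ + X]big_nat_recr //=.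
rewrite addrACA [X in X + _]IH invrK.
rewrite (_ : p / (p / u) = u); last by field; rewrite p_neq0 u0.
rewrite (qfactSl u^-1) (qfactSl u) 3!qfactS -!(mulrAC _ (p ^+ K)) -!exprS.
have := qfact_neq0 K; have := qfact_neq0 K.+1; have := den1_neq0 K.+1.
rewrite qfactS -exprS mulf_eq0 negb_or.
set P := p ^+ K.+1; set Z := qfact p p K.
set X := qfact (p * u) p K; set Y := qfact (p / u) p K.
move=> P1 /andP[Z0 P2] _.
by field; rewrite u0 P1 P2 Z0.
Qed.

(** For [u = p^(N+1)] the right-hand side of the contiguous relation contains
    the factor [1 - p^(-N) p^N], so passing from [N] to [N + 1] only changes the
    sign; for [N = 0] all terms but the first vanish. *)
Lemma phi_sum_negpow K N : (N < K)%N -> phi_sum p K (p ^- N) = (-1) ^+ N.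
Proof.
case: K => // K; elim: N => [_|N IH NK].
  rewrite expr0 invr1 /phi_sum big_nat_recl // big1_seq ?addr0 => [|k _].
    rewrite /qfact !big_nil expr0 expr1n !mulr1 mul1r divff //.
    by have := den1_neq0 0; rewrite expr0.
  by rewrite (@qfact_eq0 _ 1 _ _ 0) ?expr0 ?mulr1 // mulr0 !mul0r.
have u0 : p ^+ N.+1 != 0 by rewrite expf_neq0.
have := phi_sum_contiguous K u0.
rewrite (_ : p / p ^+ N.+1 = p ^- N); last first.
  by rewrite exprS; field; rewrite p_neq0 expf_neq0.
rewrite (@qfact_eq0 _ (p ^- N) _ _ N) ?mulVf ?expf_neq0 //.
rewrite mulr0 mul0r IH 1?ltnW // => /eqP; rewrite addr_eq0 => /eqP ->.
by rewrite exprS mulN1r.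
Qed.

Lemma phi_sum_pow K N : (N < K)%N -> phi_sum p K (p ^+ N.+1) = (-1) ^+ N.
Proof.
move=> NK; rewrite -phi_sumC ?expf_neq0 // exprS invfM mulrA divff // mul1r.
exact: phi_sum_negpow.
Qed.

End ThreePhiTwo.

(** * Clearing denominators *)

(** Distinct roots split off as linear factors over any domain, although their
    differences need not be invertible: cancellation suffices. *)
Lemma root_factors (R : idomainType) (P : {poly R}) (rs : seq R) :
  uniq rs -> all (root P) rs ->
  exists Q : {poly R}, P = Q * \prod_(z <- rs) ('X - z%:P).
Proof.
elim: rs P => [|z rs IH] P /=; first by exists P; rewrite big_nil mulr1.
case/andP=> zrs Urs /andP[/factor_theorem[P1 ->] Prs].
have [|Q ->] := IH P1 Urs.
  apply/allP => y yrs; have := allP Prs y yrs.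
  rewrite rootM root_XsubC => /orP[//|/eqP yz].
  by rewrite -yz yrs in zrs.
by exists Q; rewrite big_cons mulrAC mulrA.
Qed.

Lemma rmorph_qfact (R S : pzRingType) (f : {rmorphism R -> S}) x p k :
  f (qfact x p k) = qfact (f x) (f p) k.
Proof.
rewrite /qfact rmorph_prod; apply: eq_bigr => i _.
by rewrite rmorphB rmorph1 rmorphM rmorphXn.
Qed.

(** One factor of [(A a;g)_k (b/A;g)_k] for [A = y/d]: multiplying it by [d y]
    leaves a polynomial in [y]. *)
Lemma clear_denominators (F : fieldType) (y d a b g : F) : y != 0 -> d != 0 ->
  (d - a * g * y) * (y - d * b * g)
  = d * y * ((1 - y / d * a * g) * (1 - b / (y / d) * g)).
Proof. by move=> y0 d0; field; rewrite y0 d0. Qed.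

Lemma mulr_denomK (F : fieldType) (d D e u v w g : F) : D != 0 ->
  d * e * g * (u * (v * w)) = (d * D) * u * (e * v * w * g / D).
Proof. by move=> D0; field. Qed.

Section PolynomialValued.
Variable R : idomainType.
Local Notation F := {fraction R}.

(** Working with functions rather than with explicit polynomials lets the
    formulas of the fraction field be used as they stand; [x = 0] is excluded
    because [x] occurs in denominators. *)
Definition polynomial_on (f : R -> F) :=
  exists P : {poly R}, forall x, x != 0 -> (P.[x])%:F = f x.

Lemma polynomial_onM f g :
  polynomial_on f -> polynomial_on g -> polynomial_on (fun x => f x * g x).
Proof.
case=> [P HP] [Q HQ]; exists (P * Q) => x x0.
by rewrite hornerM rmorphM /= HP ?HQ.
Qed.

Lemma polynomial_on_sum K (f : nat -> R -> F) :
  (forall k, (k < K)%N -> polynomial_on (f k)) ->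
  polynomial_on (fun x => \sum_(0 <= k < K) f k x).
Proof.
elim: K => [|K IH] Hf.
  by exists 0 => x _; rewrite big_geq // horner0 rmorph0.
have [|P HP] := IH; first by move=> k kK; apply: Hf; rewrite ltnW.
have [Q HQ] := Hf K (leqnn _).
exists (P + Q) => x x0.
by rewrite hornerD rmorphD /= HP ?HQ // big_nat_recr.
Qed.

Lemma polynomial_on_qfacts (c alpha beta gam : R) k L : c != 0 -> (k <= L)%N ->
  polynomial_on (fun x => (c%:F * x%:F) ^+ L *
    (qfact (x%:F / c%:F * alpha%:F) gam%:F k
       * qfact (beta%:F / (x%:F / c%:F)) gam%:F k)).
Proof.
move=> c0 kL.
exists ((c *: 'X) ^+ (L - k) * \prod_(0 <= i < k)
  ((c%:P - (alpha * gam ^+ i) *: 'X)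
    * ('X - (c * beta * gam ^+ i)%:P))) => x x0.
rewrite hornerM horner_exp hornerZ hornerX rmorphM rmorphXn rmorphM /=.
rewrite -[in RHS](subnK kL) exprD -mulrA; congr (_ * _).
rewrite horner_prod rmorph_prod /qfact -big_split.
rewrite -(subn0 k) -prodr_const_nat subn0 -big_split.
apply: eq_bigr => i _ /=.
rewrite !hornerE rmorphM !rmorphB /= !rmorphM !rmorphXn /=.
by rewrite -[RHS]mulrA; apply: clear_denominators; rewrite tofrac_eq0.
Qed.

Lemma polynomial_on_cst c : polynomial_on (fun=> c%:F).
Proof. by exists c%:P => x _; rewrite hornerC. Qed.

(** The substitution [A = x / c] moves the points [A] of interest, which are
    negative powers of [p] among others, to elements [x] of the ring itself.
    The divisor [beta] of [gam] keeps [gam / (A alpha)] integral in [1 / A]. *)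
Lemma polynomial_on_phi_sum (E c alpha gam : R) K L :
  c != 0 -> alpha != 0 -> (K <= L)%N ->
  (exists beta, gam = alpha * beta) ->
  (forall k, (k < K)%N -> qfact gam gam k ^+ 2 * (1 + gam ^+ k) != 0 /\
     exists d, E = d * (qfact gam gam k ^+ 2 * (1 + gam ^+ k))) ->
  polynomial_on (fun x => E%:F * (c%:F * x%:F) ^+ L *
    phi_sum gam%:F K (x%:F / c%:F * alpha%:F)).
Proof.
move=> c0 a0 KL [beta gamE] HE.
have [P HP] : polynomial_on (fun x =>
  \sum_(0 <= k < K) (E%:F * (c%:F * x%:F) ^+ L *
  (2%:R * qfact (x%:F / c%:F * alpha%:F) gam%:F k
    * qfact (gam%:F / (x%:F / c%:F * alpha%:F)) gam%:F k * gam%:F ^+ k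
    / (qfact gam%:F gam%:F k ^+ 2 * (1 + gam%:F ^+ k))))).
  apply: polynomial_on_sum => k kK.
  have [den0 [d Ed]] := HE k kK.
  have [P HP] := polynomial_onM (polynomial_on_cst (d * 2%:R * gam ^+ k))
    (polynomial_on_qfacts alpha beta gam c0 (ltnW (leq_trans kK KL))).
  exists P => x x0; rewrite HP // Ed !rmorphM /= rmorph_nat rmorphD rmorph1.
  rewrite !rmorphXn /= rmorph_qfact.
  have -> : gam%:F / (x%:F / c%:F * alpha%:F) = beta%:F / (x%:F / c%:F).
    have aF : alpha%:F != 0 by rewrite tofrac_eq0.
    rewrite [in LHS]gamE rmorphM /= [X in _ / X]mulrC -mulf_div.
    by rewrite divff // mul1r.
  move: den0; rewrite -tofrac_eq0 rmorphM rmorphXn rmorphD rmorph1 /=.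
  rewrite rmorph_qfact rmorphXn /=.
  by move=> D0; apply: mulr_denomK.
by exists P => x x0; rewrite HP // /phi_sum mulr_sumr.
Qed.

End PolynomialValued.

Lemma qfact_cat (R : comPzRingType) (x p : R) k l : (k <= l)%N ->
  qfact x p l = qfact x p k * \prod_(k <= i < l) (1 - x * p ^+ i).
Proof. by move=> kl; rewrite /qfact (big_cat_nat (n := k)). Qed.

Lemma qfact_exp_dvd (R : comPzRingType) (p : R) n k : (0 < n)%N ->
  exists d, qfact p p (n * k) = d * qfact (p ^+ n) (p ^+ n) k.
Proof.
move=> n0; elim: k => [|k [d IH]].
  by exists 1; rewrite muln0 /qfact !big_nil mul1r.
rewrite (@qfact_cat _ _ _ (n * k)) ?leq_mul // IH qfactS.
have -> : (n * k.+1 = (n * k + n.-1).+1)%N.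
  by rewrite mulnS -addnS prednK // addnC.
rewrite big_nat_recr ?leq_addr //= -exprS -addnS prednK //.
rewrite -exprM -exprD [(n + _)%N]addnC mulrACA.
by eexists.
Qed.

(** * Divisibility of the difference by linear factors *)

Section Gap.
Variables (R : idomainType) (p : R).
Hypothesis p_neq0 : p != 0.
Hypothesis pX_neq1 : forall k, (0 < k)%N -> p ^+ k != 1.
Hypothesis pX_neqN1 : forall k, p ^+ k != -1.
Variables (n M t : nat).
Hypothesis n_odd : odd n.
Hypothesis M_gt0 : (0 < M)%N.
Hypothesis t_lt : (t < n)%N.

Let n_gt0 : (0 < n)%N. Proof. by case: n n_odd. Qed.
Let L := (n * M)%N.
(** The shift for which the zeros [A = p^(nl - t)], [-M < l <= M], become
    [A p^w = p^(nj)] with [0 <= j < 2M]. *)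
Let w := (t + n * M.-1)%N.

(** A common denominator of both sums.  Its first factor is as small as
    possible, since its cyclotomic factors will be counted exactly; the second
    one, for [p] a power of [q], is prime to the [Phi_(n^j)]. *)
Definition common_denom :=
  qfact p p L.-1 ^+ 2 * \prod_(0 <= i < L) (1 + p ^+ i).

Let denom_neq0 e k : (0 < e)%N ->
  qfact (p ^+ e) (p ^+ e) k ^+ 2 * (1 + (p ^+ e) ^+ k) != 0.
Proof.
move=> e0; rewrite mulf_neq0 ?expf_neq0 //.
  rewrite /qfact prodf_seq_neq0; apply/allP => i _ /=.
  by rewrite -exprS -exprM subr_eq0 eq_sym pX_neq1 // muln_gt0 e0.
by rewrite -exprM addrC -[1]opprK subr_eq0 pX_neqN1.
Qed.

Let denom_dvd e k : (0 < e)%N -> (e * k < L)%N ->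
  exists d, common_denom =
    d * (qfact (p ^+ e) (p ^+ e) k ^+ 2 * (1 + (p ^+ e) ^+ k)).
Proof.
move=> e0 ekL; have [d Hd] := qfact_exp_dvd p k e0.
have ekL1 : (e * k <= L.-1)%N by rewrite -ltnS prednK ?(leq_ltn_trans _ ekL).
rewrite /common_denom (qfact_cat _ _ ekL1) Hd.
have ekI : (e * k)%N \in index_iota 0 L by rewrite mem_index_iota.
rewrite (bigD1_seq _ ekI (iota_uniq _ _)) /= exprM.
move: (qfact _ _ k) ((p ^+ e) ^+ k) => x y.
set T := \prod_(_ <= _ < _) _; set Y := \prod_(_ <- _ | _) _.
by exists ((d * T) ^+ 2 * Y); ring.
Qed.

Lemma expr_muln_inj : injective (fun j => p ^+ (n * j)).
Proof.
have le_case i j : (i <= j)%N -> p ^+ (n * i) = p ^+ (n * j) -> i = j.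
  move=> ij; rewrite -[in RHS](subnK ij) mulnDr exprD.
  rewrite -[LHS]mul1r => /(mulIf (expf_neq0 _ p_neq0)) /esym/eqP.
  case: (posnP (j - i)) => [|ji]; first lia.
  by rewrite (negPf (pX_neq1 _)) // muln_gt0 n_gt0.
move=> i j; case/orP: (leq_total i j) => ij; first exact: le_case.
by move/esym/(le_case _ _ ij).
Qed.

Let gap (A : {fraction R}) :=
  phi_sum p%:F L A - (-1) ^+ t * phi_sum (p ^+ n)%:F M (A * p%:F ^+ t).

Let pF0 : p%:F != 0. Proof. by rewrite tofrac_eq0. Qed.
Let pF1 k : (0 < k)%N -> p%:F ^+ k != 1.
Proof. by move=> k0; rewrite -tofracXn -tofrac1 tofrac_eq pX_neq1. Qed.
Let pFN1 k : p%:F ^+ k != -1.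
Proof. by rewrite -tofracXn -tofrac1 -tofracN tofrac_eq. Qed.
Let pnF0 : (p ^+ n)%:F != 0. Proof. by rewrite tofrac_eq0 expf_neq0. Qed.
Let pnF1 k : (0 < k)%N -> (p ^+ n)%:F ^+ k != 1.
Proof. by move=> k0; rewrite tofracXn -exprM pF1 // muln_gt0 n_gt0. Qed.
Let pnFN1 k : (p ^+ n)%:F ^+ k != -1.
Proof. by rewrite tofracXn -exprM. Qed.

(** For [j < M] both sums terminate at negative powers, with [(-1)^(t + nN)] and
    [(-1)^N], [N = M - 1 - j]; for [j >= M] they terminate at positive powers,
    with [(-1)^(nN + n - 1 - t)] and [(-1)^N], [N = j - M].  As [n] is odd, the
    sign [(-1)^t] reconciles the two values in each case. *)
Lemma gap_eq0 j : (j < M.*2)%N -> gap ((p ^+ (n * j))%:F / (p ^+ w)%:F) = 0.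
Proof.
move=> jM; have [jM1|jM1] := ltnP j M.
- pose N := (M.-1 - j)%N.
  have -> : (p ^+ (n * j))%:F / (p ^+ w)%:F = p%:F ^- (t + n * N).
    rewrite !tofracXn (_ : w = n * j + (t + n * N))%N; last first.
      by rewrite addnCA -mulnDr subnKC //; lia.
    by rewrite exprD invfM mulrA divff ?mul1r // expf_neq0.
  rewrite /gap phi_sum_negpow //; last first.
    have : (n * N.+1 <= L)%N by rewrite leq_mul2l /N; apply/orP; right; lia.
    by rewrite mulnS; move: t_lt; move: (n * N)%N L => a b; lia.
  have -> : p%:F ^- (t + n * N) * p%:F ^+ t = (p ^+ n)%:F ^- N.
    rewrite tofracXn -exprM exprD invfM mulrAC mulVf ?mul1r //.
    by rewrite expf_neq0.
  rewrite phi_sum_negpow //; last by rewrite /N; lia.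
  rewrite -exprD -[(-1) ^+ (t + n * N)]signr_odd -[(-1) ^+ (t + N)]signr_odd.
  by rewrite !oddD oddM n_odd subrr.
pose N := (j - M)%N.
have -> : (p ^+ (n * j))%:F / (p ^+ w)%:F = p%:F ^+ (n * N + (n.-1 - t)).+1.
  rewrite !tofracXn (_ : n * j = (n * N + (n.-1 - t)).+1 + w)%N; last first.
    have -> : (n * j = n * N + n * M.-1 + n)%N.
      by rewrite -mulnDr -mulnSr; congr muln; rewrite /N; lia.
    by rewrite /w; move: n_gt0 t_lt; move: (n * N)%N (n * M.-1)%N => a b; lia.
  by rewrite exprD mulfK // expf_neq0.
rewrite /gap phi_sum_pow //; last first.
  have : (n * N.+1 <= L)%N by rewrite leq_mul2l /N; apply/orP; right; lia.
  rewrite mulnS; move: n_gt0 t_lt; move: (n * N)%N L => a b; lia.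
have -> : p%:F ^+ (n * N + (n.-1 - t)).+1 * p%:F ^+ t = (p ^+ n)%:F ^+ N.+1.
  rewrite tofracXn -exprM -exprD; congr (_ ^+ _).
  by rewrite mulnS; move: n_gt0 t_lt; move: (n * N)%N => a; lia.
rewrite phi_sum_pow //; last by rewrite /N; lia.
rewrite -exprD -[(-1) ^+ (n * N + _)]signr_odd -[(-1) ^+ (t + N)]signr_odd.
rewrite !oddD oddM oddB; last by lia.
have -> : odd n.-1 = false.
  by move: n_odd; rewrite -[in odd n](prednK n_gt0) /= => /negPf.
by rewrite n_odd addbC subrr.
Qed.

Theorem gap_factorization : exists Q : {poly R}, forall x, x != 0 ->
  common_denom%:F * ((p ^+ w)%:F * x%:F) ^+ L * gap (x%:F / (p ^+ w)%:F)
  = (Q.[x] * \prod_(0 <= j < M.*2) (x - p ^+ (n * j)))%:F.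
Proof.
have w0 : p ^+ w != 0 by rewrite expf_neq0.
have [G HG] : polynomial_on (fun x =>
    common_denom%:F * ((p ^+ w)%:F * x%:F) ^+ L * gap (x%:F / (p ^+ w)%:F)).
  have [G1 H1] : polynomial_on (fun x => common_denom%:F *
      ((p ^+ w)%:F * x%:F) ^+ L * phi_sum p%:F L (x%:F / (p ^+ w)%:F * 1%:F)).
    apply: polynomial_on_phi_sum => //; first exact: oner_neq0.
      by exists p; rewrite mul1r.
    move=> k kL; have := denom_neq0 k (ltn0Sn 0).
    by have := @denom_dvd 1 k (ltn0Sn 0); rewrite expr1 mul1n => /(_ kL).
  have [G2 H2] : polynomial_on (fun x => common_denom%:F *
      ((p ^+ w)%:F * x%:F) ^+ L
      * phi_sum (p ^+ n)%:F M (x%:F / (p ^+ w)%:F * (p ^+ t)%:F)).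
    apply: polynomial_on_phi_sum => //; first exact: expf_neq0.
    - exact: leq_pmull.
    - by exists (p ^+ (n - t)); rewrite -exprD subnKC // ltnW.
    move=> k kM; split; first exact: denom_neq0.
    by apply: denom_dvd; rewrite // ltn_pmul2l.
  exists (G1 - (-1) ^+ t *: G2) => x x0.
  rewrite hornerD hornerN hornerZ rmorphB rmorphM /= H1 // H2 //.
  rewrite rmorph_sign rmorph1 mulr1 /gap mulrBr; congr (_ - _).
  by rewrite [RHS]mulrCA (tofracXn t p).
have pows_neq0 j : p ^+ (n * j) != 0 by rewrite expf_neq0.
have [||Q GE] := @root_factors _ G [seq p ^+ (n * j) | j <- iota 0 M.*2].
- by rewrite map_inj_uniq ?iota_uniq //; exact: expr_muln_inj.
- apply/allP => z /mapP[j]; rewrite mem_iota => /andP[_ jM] ->.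
  by rewrite /root -tofrac_eq0 HG // gap_eq0 // mulr0.
exists Q => x x0; rewrite -HG // GE hornerM big_map horner_prod.
congr ((_ * _)%:F); rewrite /index_iota subn0.
by apply: eq_bigr => j _; rewrite hornerXsubC.
Qed.

End Gap.

(** * Lowest terms over the integers *)

(** A common divisor is a constant, and this constant divides both contents. *)
Lemma zpcoprime_contents (A B : {poly int}) :
  B != 0 -> (forall C, C %| A -> C %| B -> (size C <= 1)%N) ->
  coprimez (zcontents A) (zcontents B) -> zpcoprime A B.
Proof.
move=> B0 common coAB C [U AU] [V BV].
have C0 : C != 0 by apply: contraNneq B0 => C0; rewrite BV C0 mul0r.
have sC : (size C <= 1)%N.
  by apply: common; rewrite ?AU ?BV dvdp_mulIl.
have [c Cc] : exists c, C = c%:P by exists C`_0; exact: size1_polyC.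
have : (zcontents C %| gcdz (zcontents A) (zcontents B))%Z.
  rewrite dvdz_gcd AU BV !zcontentsM.
  by apply/andP; split; apply: dvdz_mulr; apply: dvdzz.
rewrite (eqP coAB) dvdz1 => /eqP C1.
have zc : zcontents C = c.
  by rewrite Cc -alg_polyC zcontentsZ zcontents_monic ?monic1 ?mulr1.
rewrite zc in C1; have [c1|c1] : c = 1 \/ c = -1 by lia.
  by rewrite Cc c1 unitr1.
by rewrite Cc c1 polyCN unitrN unitr1.
Qed.

(** Z[q] is a UFD: the gcd over the rationals, made primitive, is cancelled
    first, and then the gcd of the contents. *)
Lemma reduced_form (N D : {poly int}) : D != 0 ->
  exists A1 A2 : {poly int}, [/\ A2 != 0, zpcoprime A1 A2 & N * A2 = A1 * D].
Proof.
move=> D0; set G := zprimitive (gcdp N D).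
have G0 : G != 0 by rewrite zprimitive_eq0 gcdp_eq0 negb_and D0 orbT.
have [N1 NE] : {r | N = G * r} by apply: dvdpP_int; exact: dvdp_gcdl.
have [D1 DE] : {r | D = G * r} by apply: dvdpP_int; exact: dvdp_gcdr.
have D10 : D1 != 0 by apply: contraNneq D0 => D10; rewrite DE D10 mulr0.
set g := gcdz (zcontents N1) (zcontents D1).
have g0 : g != 0 by rewrite gcdz_eq0 negb_and !zcontents_eq0 D10 orbT.
have /dvdzP[u uE] : (g %| zcontents N1)%Z by exact: dvdz_gcdl.
have /dvdzP[v vE] : (g %| zcontents D1)%Z by exact: dvdz_gcdr.
have N1E : N1 = g *: (u *: zprimitive N1).
  by rewrite scalerA mulrC -uE -zpolyEprim.
have D1E : D1 = g *: (v *: zprimitive D1).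
  by rewrite scalerA mulrC -vE -zpolyEprim.
set N2 := u *: _ in N1E; set D2 := v *: _ in D1E.
have N2u : zcontents N2 = u.
  by apply: (mulfI g0); rewrite -zcontentsZ -N1E uE mulrC.
have D2v : zcontents D2 = v.
  by apply: (mulfI g0); rewrite -zcontentsZ -D1E vE mulrC.
have D20 : D2 != 0 by apply: contraNneq D10 => D20; rewrite D1E D20 scaler0.
exists N2, D2; split => //; last first.
  by rewrite NE DE N1E D1E -!mul_polyC; ring.
apply: zpcoprime_contents => //.
  move=> C CN CD; have C0 : C != 0 by apply: contraTneq CD => ->; rewrite dvd0p.
  have : G * C %| gcdp N D.
    by rewrite dvdp_gcd NE DE !dvdp_mul2l // N1E D1E !(dvdpZr _ _ g0) CN CD.
  move/dvdp_leq; rewrite gcdp_eq0 negb_and D0 orbT => /(_ isT).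
  rewrite -(size_zprimitive (gcdp N D)) -/G size_mul //.
  move: (size_poly_gt0 G); rewrite G0; case: (size G) => // k _.
  by rewrite addSn /=; lia.
rewrite N2u D2v /coprimez; apply/eqP.
have g0' : `|g|%N%:Z != 0 by rewrite eqz_nat absz_eq0.
by apply: (mulIf g0'); rewrite mulz_gcdl -uE -vE mul1r.
Qed.

(** By Gauss's lemma, divisibility by a monic polynomial does not depend on
    whether the coefficients are taken in Z, Q or the algebraic numbers. *)
Lemma monic_dvdp_pZtoC (P A : {poly int}) :
  P \is monic -> pZtoC P %| pZtoC A -> zpdvd P A.
Proof.
move=> mP.
have toQ (B : {poly int}) : pZtoC B = map_poly (@ratr algC) (map_poly intr B).
  by rewrite -map_poly_comp; apply: eq_map_poly => a; rewrite /= ratr_int.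
rewrite !toQ dvdp_map dvdp_rat_int => /dvdpP_int[U AE].
by exists U; rewrite AE zprimitive_monic.
Qed.

(** Lowest terms need not be computed: if [A1 / A2] is the reduced form, then
    [P] divides [A1 W], and [P] has no root in common with [W]. *)
Lemma rf_congr_coprime (B C : ratfun) (V W P : {poly int}) :
  W != 0 -> P \is monic -> coprimep (pZtoC P) (pZtoC W) ->
  W%:F * (B - C) = (V * P)%:F -> rf_congr B C P.
Proof.
move=> W0 mP coPW WBC.
have [A1 [A2 [A20 coA E]]] := reduced_form (V * P) W0.
have WF : W%:F != 0 by rewrite tofrac_eq0.
have A2F : A2%:F != 0 by rewrite tofrac_eq0.
exists A1, A2; split => //.
  apply: (mulfI WF); rewrite WBC; apply: (mulIf A2F).
  by rewrite -rmorphM E rmorphM /= mulrA mulfVK // mulrC.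
apply: monic_dvdp_pZtoC => //.
rewrite -(Gauss_dvdpl _ coPW) -rmorphM -E !rmorphM /=.
by rewrite mulrAC dvdp_mull.
Qed.

(** * Multiplicities of cyclotomic polynomials *)

(** As [m] is invertible modulo [d], [i |-> b + m i] permutes the residues. *)
Lemma sum_dvdn_period (m b d : nat) : (0 < d)%N -> coprime m d ->
  (\sum_(0 <= i < d) (d %| b + m * i) = 1)%N.
Proof.
move=> d0 co; rewrite big_mkord.
pose f (i : 'I_d) := Ordinal (ltn_pmod (b + m * i) d0).
have fI : injective f.
  have le_case (i j : 'I_d) : (i <= j)%N -> f i = f j -> i = j.
    move=> ij /(congr1 val) /= /esym/eqP; rewrite eqn_modDl.
    rewrite eqn_mod_dvd ?leq_mul // -mulnBr Gauss_dvdr 1?coprime_sym // => dv.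
    apply/val_inj/eqP; rewrite eqn_leq ij -subn_eq0; apply/negPn/negP => ji.
    have := dvdn_leq _ dv; rewrite lt0n ji => /(_ isT).
    by rewrite leqNgt (leq_ltn_trans (leq_subr _ _) (ltn_ord j)).
  move=> i j; case/orP: (leq_total i j) => ij; first exact: le_case.
  by move/esym/(le_case _ _ ij).
transitivity (\sum_(i < d) (val (f i) == 0 : nat))%N; first by [].
rewrite -(reindex_inj fI (P := xpredT)
  (F := fun i : 'I_d => (val i == 0 : nat)%N)) /=.
rewrite (bigD1 (Ordinal d0)) //= big1 ?addn0 // => i.
by rewrite -val_eqE /= => /negPf ->.
Qed.

Lemma sum_dvdn_periods (m b d k : nat) : (0 < d)%N -> coprime m d ->
  (\sum_(0 <= i < d * k) (d %| b + m * i) = k)%N.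
Proof.
move=> d0 co; elim: k => [|k IH]; first by rewrite muln0 big_geq.
rewrite (big_cat_nat (n := (d * k)%N)) ?leq_mul //= IH.
rewrite -{1}[(d * k)%N]add0n big_addn mulnS addnK.
rewrite (eq_bigr (fun i : nat => (d %| b + m * i) : nat)); last first.
  by move=> i _; rewrite mulnDr addnA mulnCA dvdn_addl // dvdn_mulr.
by rewrite sum_dvdn_period // addn1.
Qed.

Section Cyclo.
Variables n r : nat.
Hypothesis n_gt1 : (1 < n)%N.

(** Being prime to [Phi_(n^j)] for all [1 <= j <= r], expressed by roots so that
    stability under products is immediate. *)
Definition avoids (W : {poly int}) := forall j z, (0 < j < r.+1)%N ->
  (n ^ j).-primitive_root z -> ~~ root (pZtoC W) z.

Lemma avoidsM A B : avoids A -> avoids B -> avoids (A * B).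
Proof.
move=> HA HB j z jr pz.
by rewrite rmorphM rootM negb_or (HA j) // (HB j).
Qed.

Lemma avoids_prod (I : Type) (s : seq I) (Q : pred I) (f : I -> {poly int}) :
  (forall i, Q i -> avoids (f i)) -> avoids (\prod_(i <- s | Q i) f i).
Proof.
move=> Hf; apply: big_ind => //; last exact: avoidsM.
by move=> j z _ _; rewrite rmorph1 root1.
Qed.

Lemma avoidsX A k : avoids A -> avoids (A ^+ k).
Proof.
move=> HA; elim: k => [|k IH]; first by move=> j z _ _; rewrite rmorph1 root1.
by rewrite exprS; apply: avoidsM.
Qed.

Lemma avoidsXn k : avoids 'X^k.
Proof.
apply: avoidsX => j z jr pz; rewrite map_polyX rootX.
have := prim_order_gt0 pz; have := prim_expr_order pz.
case: (n ^ j)%N => // k' + _.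
by apply: contra_eqN => /eqP ->; rewrite expr0n /= eq_sym oner_eq0.
Qed.

Lemma avoids_sign k : avoids ((-1) ^+ k).
Proof.
apply: avoidsX => j z _ _; rewrite rmorphN1 rootE hornerN hornerC.
by rewrite oppr_eq0 oner_eq0.
Qed.

(** If [z^k = -1], then raising to the odd power [n^j], the order of [z], gives
    [1 = -1]. *)
Lemma avoids_Xn_add1 k : odd n -> avoids (1 + 'X^k).
Proof.
move=> on j z jr pz; rewrite rmorphD rmorph1 /= map_polyXn rootE !hornerE.
apply/eqP => /eqP; rewrite addrC addr_eq0 => /eqP zk.
have := prim_expr_order pz => /(congr1 (fun y => y ^+ k)).
rewrite exprAC zk expr1n -signr_odd oddX on orbT expr1 => /eqP.
by rewrite eq_sym -addr_eq0 -mulr2n pnatr_eq0.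
Qed.

Definition cycpart (g : nat -> nat) :=
  \prod_(1 <= j < r.+1) 'Phi_(n ^ j) ^+ g j.

(** [X^e - 1] is the product of the [Phi_d] with [d | e]; those with [d] not
    among the [n^j] have no primitive [n^j]-th root of unity as a root. *)
Lemma Xn_sub1_split e : (0 < e)%N -> exists2 U, avoids U &
  'X^e - 1 = U * cycpart (fun j => (n ^ j %| e)%N : nat).
Proof.
move=> e0; rewrite -prod_Cyclotomic //.
pose S := [seq (n ^ j)%N | j <- index_iota 1 r.+1].
rewrite (bigID (mem S)) /= mulrC; eexists; last first.
  congr (_ * _); rewrite -big_filter.
  transitivity (\prod_(d <- [seq d <- S | (d %| e)%N]) 'Phi_d).
    apply: perm_big; apply: uniq_perm.
    - by rewrite filter_uniq ?divisors_uniq.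
    - rewrite filter_uniq // map_inj_uniq ?iota_uniq //; exact: expnI.
    by move=> d; rewrite !mem_filter -dvdn_divisors // andbC.
  rewrite big_filter big_map /cycpart [LHS]big_mkcond /=.
  by apply: eq_bigr => j _; case: ifP => _; rewrite ?expr1 ?expr0.
rewrite big_seq_cond; apply: avoids_prod => d /andP[de dS] j z jr pz.
have d0 : (0 < d)%N by move: de; rewrite -dvdn_divisors // => /dvdn_gt0 ->.
have [w pw] := C_prim_root_exists d0.
rewrite (Cintr_Cyclotomic pw) root_cyclotomic //; apply: contra dS => pz'.
have -> : d = (n ^ j)%N.
  apply/eqP; rewrite eqn_dvd (prim_order_dvd pz') (prim_order_dvd pz).
  by rewrite !prim_expr_order // eqxx.
by apply: map_f; rewrite mem_index_iota.
Qed.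

Lemma prod_Xn_sub1_split K (f : nat -> nat) : (forall i, 0 < f i)%N ->
  exists2 U, avoids U & \prod_(0 <= i < K) ('X^(f i) - 1)
    = U * cycpart (fun j => \sum_(0 <= i < K) (n ^ j %| f i))%N.
Proof.
move=> f0; elim: K => [|K [U HU IH]].
  exists 1; first by move=> j z _ _; rewrite rmorph1 root1.
  by rewrite big_geq // mul1r /cycpart big1 // => j _; rewrite big_geq.
have [V HV E] := Xn_sub1_split (f0 K).
exists (U * V); first exact: avoidsM.
rewrite big_nat_recr //= IH E mulrACA; congr (_ * _).
rewrite /cycpart -big_split; apply: eq_bigr => j _ /=.
by rewrite -exprD big_nat_recr.
Qed.

Lemma cycpart_monic g : cycpart g \is monic.
Proof. by apply: monic_prod => j _; rewrite monic_exp // Cyclotomic_monic. Qed.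

Lemma eq_cycpart g h :
  (forall j, (0 < j <= r)%N -> g j = h j) -> cycpart g = cycpart h.
Proof. by move=> gh; apply: eq_big_nat => j jr; rewrite gh. Qed.

Lemma cycpartM g h : cycpart g * cycpart h = cycpart (fun j => g j + h j)%N.
Proof.
by rewrite /cycpart -big_split; apply: eq_bigr => j _; rewrite exprD.
Qed.

Lemma coprime_avoids W g : avoids W -> coprimep (pZtoC (cycpart g)) (pZtoC W).
Proof.
move=> HW; rewrite /cycpart big_nat_cond.
apply: (big_ind (fun A => coprimep (pZtoC A) (pZtoC W))).
- by rewrite rmorph1 coprime1p.
- by move=> A B HA HB; rewrite rmorphM coprimepMl HA HB.
move=> j; rewrite andbT => jr; rewrite rmorphXn coprimep_expl //=.
have nj0 : (0 < n ^ j)%N by rewrite expn_gt0 ltnW.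
have [w pw] := C_prim_root_exists nj0.
apply/Pdiv.ClosedField.coprimepP => z.
by rewrite (Cintr_Cyclotomic pw) root_cyclotomic //; apply: HW.
Qed.

End Cyclo.

(** * Extraction of the cyclotomic factors *)

Section QuotientByCyclotomics.
Variables m s s' t n r : nat.
Hypothesis n_gt1 : (1 < n)%N.
Hypothesis n_odd : odd n.
Hypothesis co_mn : coprime m n.
Hypothesis s'_gt0 : (0 < s')%N.
Hypothesis s'_lt : (s' < m)%N.
Hypothesis t_lt : (t < n)%N.
Hypothesis tE : (n * s' = s + m * t)%N.
Hypothesis r_gt0 : (0 < r)%N.

Let m_gt0 : (0 < m)%N. Proof. exact: leq_ltn_trans s'_lt. Qed.
Let n_gt0 : (0 < n)%N. Proof. exact: ltnW. Qed.
Let M := (n ^ r.-1)%N.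
Let LE : (n * M = n ^ r)%N. Proof. by rewrite -expnS prednK. Qed.
Let M_gt0 : (0 < M)%N. Proof. by rewrite expn_gt0 n_gt0. Qed.
Let w := (t + n * M.-1)%N.
Let p : {poly int} := 'X^m.
(** The value [A p^w] of the shifted parameter at [A = q^s]. *)
Let x : {poly int} := 'X^(s + m * w).
Let g (j : nat) := (n ^ (r - j))%N.

Let co_nj j : coprime m (n ^ j). Proof. exact: coprimeXr. Qed.

Lemma count_numer b j : (0 < j <= r)%N ->
  (\sum_(0 <= i < M) (n ^ j %| n * (b + m * i)) = g j)%N.
Proof.
case: j => // j /= jr.
rewrite -[RHS](sum_dvdn_periods b (d := n ^ j) _ _ (co_nj j)) //; last first.
  by rewrite expn_gt0 n_gt0.
rewrite -expnD (_ : j + (r - j.+1) = r.-1)%N; last by lia.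
by apply: eq_bigr => i _; rewrite expnS dvdn_pmul2l.
Qed.

(** The index [0] of a full set of periods is missing from the product
    [(p;p)_(nM-1)]: this missing factor, twice, is the source of the squares
    in the modulus. *)
Lemma count_denom j : (0 < j <= r)%N ->
  ((\sum_(0 <= i < (n * M).-1) (n ^ j %| m * i.+1)).+1 = g j)%N.
Proof.
case/andP=> j0 jr.
rewrite -[RHS](sum_dvdn_periods 0 (d := n ^ j) _ _ (co_nj j)) //; last first.
  by rewrite expn_gt0 n_gt0.
rewrite -expnD subnKC // -LE.
have LM : (n * M = (n * M).-1.+1)%N by rewrite prednK // muln_gt0 n_gt0.
by rewrite [in RHS]LM big_nat_recl // muln0 dvdn0.
Qed.

Lemma numer_half b : (0 < b)%N -> exists U,
  \prod_(0 <= i < M) ('X^(n * (b + m * i)) - 1) = U * cycpart n r g.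
Proof.
move=> b0; have f0 i : (0 < n * (b + m * i))%N.
  by rewrite muln_gt0 n_gt0 addn_gt0 b0.
have [U _ ->] := prod_Xn_sub1_split r n_gt1 M f0.
by exists U; congr (_ * _); apply: eq_cycpart => j; apply: count_numer.
Qed.

Let xE : (s + m * w = n * (s' + m * M.-1))%N.
Proof. by rewrite mulnDr tE /w mulnDr addnA mulnCA. Qed.

(** The linear factors with [j < M] give the exponents [n (s' + m i)] in
    decreasing order, and those with [j >= M] give [n (m - s' + m i)], with a
    sign. *)
Lemma numer_split : exists U,
  \prod_(0 <= j < M.*2) (x - p ^+ (n * j)) = U * cycpart n r g ^+ 2.
Proof.
rewrite -addnn (big_cat_nat (n := M)) ?leq_addr //=.
have -> : \prod_(M <= j < M + M) (x - p ^+ (n * j))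
    = \prod_(0 <= i < M) (x - p ^+ (n * (i + M))).
  by rewrite -{1}[M]add0n big_addn addnK.
rewrite [X in X * _]big_nat_rev add0n /=.
have [U1 E1] := numer_half s'_gt0.
have [U2 E2] : exists U, \prod_(0 <= i < M) ('X^(n * (m - s' + m * i)) - 1)
   = U * cycpart n r g by apply: numer_half; rewrite subn_gt0.
rewrite (eq_big_nat _ _ (F2 := fun i =>
  'X^(m * (n * (M - i.+1))) * ('X^(n * (s' + m * i)) - 1))); last first.
  move=> i iM; rewrite mulrBr mulr1 -exprD -exprM /x xE; congr ('X^_ - _).
  rewrite (_ : M.-1 = M - i.+1 + i)%N; last by lia.
  by move: (M - i.+1)%N => k; lia.
rewrite [X in _ * X](eq_big_nat _ _ (F2 := fun i =>
  - x * ('X^(n * (m - s' + m * i)) - 1))); last first.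
  move=> i _; rewrite mulNr mulrBr mulr1 opprB -exprM -exprD; congr (_ - 'X^_).
  rewrite xE [in LHS](_ : M = M.-1.+1); last by rewrite prednK.
  rewrite -mulnDr addnACA -mulnDr subnKC ?(ltnW s'_lt) // -mulnS mulnCA.
  by rewrite addnS [(i + _)%N]addnC.
rewrite !big_split /= E1 E2 expr2.
set A := \prod_(_ <= _ < _) _; set B := \prod_(_ <= _ < _) _.
by exists (A * U1 * (B * U2)); ring.
Qed.

Lemma denom_split : exists2 U, avoids n r U & exists2 T,
  T != 0 & common_denom p n M = U * T ^+ 2 /\
    cycpart n r g = T * cycpart n r (fun=> 1%N).
Proof.
have f0 i : (0 < m * i.+1)%N by rewrite muln_gt0 m_gt0.
have [U HU E] := prod_Xn_sub1_split r n_gt1 (n * M).-1 f0.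
set T := cycpart _ _ _ in E.
exists (((-1) ^+ (n * M).-1 * U) ^+ 2 * \prod_(0 <= i < n * M) (1 + p ^+ i)).
  apply: avoidsM.
    by apply: avoidsX; apply: avoidsM => //; apply: avoids_sign.
  by apply: avoids_prod => i _; rewrite -exprM; apply: avoids_Xn_add1.
exists T; first by rewrite monic_neq0 // cycpart_monic.
split; last first.
  by rewrite cycpartM; apply: eq_cycpart => j jr; rewrite addn1 count_denom.
rewrite /common_denom (_ : qfact p p _ = (-1) ^+ (n * M).-1 * (U * T)).
  by ring.
rewrite -E -[X in (-1) ^+ X]subn0 -prodr_const_nat -big_split.
by apply: eq_bigr => i _; rewrite /= mulN1r opprB -exprS -exprM.
Qed.

Let X_eq1 k : (0 < k)%N -> p ^+ k != 1.
Proof.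
move=> k0; rewrite -exprM.
apply/eqP => /(congr1 (fun P : {poly int} => size P)).
by rewrite size_polyXn size_poly1 => -[] /eqP; rewrite muln_eq0; lia.
Qed.

Let X_eqN1 k : p ^+ k != -1.
Proof.
rewrite -exprM; apply/eqP => /(congr1 (fun P : {poly int} => P.[1])).
by rewrite !hornerE expr1n.
Qed.

(** Evaluating [gap_factorization] at [A = q^s] and cancelling the cyclotomic
    factors [T^2] that its two sides share leaves on the left only factors prime
    to the modulus. *)
Lemma difference_quotient : exists2 W, avoids n r W & exists V,
  W%:F * (phi_sum (q ^+ m) (n ^ r) (q ^+ s)
    - (-1) ^+ t * phi_sum (q ^+ (m * n)) (n ^ r.-1) (q ^+ (s' * n)))
  = (V * \prod_(1 <= j < r.+1) 'Phi_(n ^ j) ^+ 2)%:F.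
Proof.
have p0 : p != 0 by rewrite monic_neq0 ?monicXn.
have x0 : x != 0 by rewrite monic_neq0 ?monicXn.
have [Q /(_ x x0)] := gap_factorization p0 X_eq1 X_eqN1 n_odd M_gt0 t_lt.
have qX k : ('X^k)%:F = q ^+ k by rewrite tofracXn.
have -> : x%:F / (p ^+ w)%:F = q ^+ s.
  rewrite /x exprD exprM rmorphM /= mulfK ?qX //.
  by rewrite tofrac_eq0 expf_neq0.
have -> : (p ^+ n)%:F = q ^+ (m * n) by rewrite -exprM qX.
have -> : q ^+ s * p%:F ^+ t = q ^+ (s' * n).
  by rewrite qX -exprM -exprD -tE mulnC.
rewrite [p%:F]qX LE.
have [U HU [T T0 [-> gE]]] := denom_split.
have [V ->] := numer_split.
move: (phi_sum _ _ _ - _) => D HD.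
exists (U * (p ^+ w * x) ^+ (n ^ r)%N).
  apply: avoidsM => //; apply: avoidsX; apply: avoidsM; last exact: avoidsXn.
  by rewrite -exprM; apply: avoidsXn.
exists (Q.[x] * V).
have TF : (T ^+ 2)%:F != 0 by rewrite tofrac_eq0 expf_neq0.
apply: (mulfI TF); rewrite mulrA -!rmorphM.
have -> : T ^+ 2 * (Q.[x] * V * \prod_(1 <= j < r.+1) 'Phi_(n ^ j) ^+ 2)
   = Q.[x] * (V * cycpart n r g ^+ 2).
  have -> : \prod_(1 <= j < r.+1) 'Phi_(n ^ j) ^+ 2
      = cycpart n r (fun=> 1%N) ^+ 2.
    by rewrite expr2 cycpartM.
  by rewrite gE exprMn; ring.
rewrite /= -HD mulrA [T ^+ 2 * _]mulrC.
by rewrite [X in X * D]rmorphM rmorphXn [X in _ * X ^+ _]rmorphM.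
Qed.

End QuotientByCyclotomics.

(** * The residue and the two congruence classes *)

(** The numerator of [-s/m - u] is [-(s + m u)] up to a divisor of [m], which is
    prime to [n]. *)
Lemma dvdz_numq_sub (m s n u : nat) : (0 < m)%N -> coprime m n ->
  (n%:Z %| numq (- s%:R / m%:R - u%:R))%Z = (n %| s + m * u)%N.
Proof.
move=> m0 co; set y := _ - _ : rat.
have mQ : m%:R != 0 :> rat by rewrite pnatr_eq0 -lt0n.
have yE : numq y * m%:Z = - (s + m * u)%N%:Z * denq y.
  apply: (@intr_inj rat); rewrite !rmorphM rmorphN /= numqE.
  rewrite mulrAC; congr (_ * _); rewrite /y mulrBl mulfVK //.
  by rewrite -!pmulrn natrD natrM opprD; congr (_ - _); rewrite mulrC.
have co_m : coprimez n%:Z m%:Z by rewrite coprimezE /= coprime_sym.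
have co_d : coprimez n%:Z (denq y).
  have : (denq y %| m%:Z)%Z.
    rewrite -(Gauss_dvdzr m%:Z (n := numq y)); last first.
      by rewrite coprimez_sym coprimezE coprime_num_den.
    by rewrite yE dvdz_mull.
  by move=> dm; apply: coprimez_dvdr dm co_m.
rewrite -(Gauss_dvdzl _ co_m) yE Gauss_dvdzl //.
by rewrite dvdzE abszN.
Qed.

Lemma least_residueE (m s s' t n : nat) : (0 < m)%N -> coprime m n ->
  (t < n)%N -> (n * s' = s + m * t)%N ->
  least_residue (- s%:R / m%:R) n = t.
Proof.
move=> m0 co tn tE; rewrite /least_residue.
rewrite (eq_find (a2 := fun u => n %| s + m * u)%N); last first.
  by move=> u; apply: dvdz_numq_sub.
have Pt : (n %| s + m * t)%N by rewrite -tE dvdn_mulr.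
have has_t : has (fun u => n %| s + m * u)%N (iota 0 n).
  by apply/hasP; exists t; rewrite // mem_iota.
set a := (fun u => _ %| _)%N in has_t *.
have fn : (find a (iota 0 n) < n)%N by rewrite -{2}(size_iota 0 n) -has_find.
have := nth_find 0 has_t; rewrite nth_iota // add0n /a -/a => Pf.
have ft : (find a (iota 0 n) <= t)%N.
  rewrite leqNgt; apply/negP => /(before_find 0).
  by rewrite nth_iota // add0n /a Pt.
have : (n %| m * (t - find a (iota 0 n)))%N.
  by rewrite mulnBr -(subnDl s) dvdn_sub.
rewrite Gauss_dvdr 1?coprime_sym // => dv.
apply/eqP; rewrite eqn_leq ft -subn_eq0; apply/negPn/negP => ne.
have := dvdn_leq _ dv; rewrite lt0n ne => /(_ isT).
by rewrite leqNgt (leq_ltn_trans (leq_subr _ _) tn).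
Qed.

Lemma q_neq0 : q != 0.
Proof. by rewrite tofrac_eq0 polyX_eq0. Qed.

Lemma phi_sum_qE (a b c K : nat) : (b + c = a)%N ->
  \sum_(0 <= k < K) 2%:R * qfact (q ^+ b) (q ^+ a) k * qfact (q ^+ c) (q ^+ a) k
     * q ^+ (a * k) / (qfact (q ^+ a) (q ^+ a) k ^+ 2 * (1 + q ^+ (a * k)))
  = phi_sum (q ^+ a) K (q ^+ b).
Proof.
move=> <-; apply: eq_bigr => k _; rewrite -exprM.
have -> // : q ^+ (b + c) / q ^+ b = q ^+ c.
by rewrite addnC exprD mulfK // expf_neq0 // q_neq0.
Qed.

Lemma avoids_neq0 n r W : (1 < n)%N -> (0 < r)%N -> avoids n r W -> W != 0.
Proof.
move=> n1 r0 HW; have [z pz] := C_prim_root_exists (ltnW n1).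
by apply: contraNneq (HW 1%N z r0 pz) => ->; rewrite rmorph0 root0.
Qed.

(** If [n = k m + 1] then [s' = s] and [t = s k]; if [n + 1 = k m] then
    [s' = m - s] and [t = n - s k]. *)
Lemma shifted_residue (m s n : nat) : (0 < s)%N -> (s < m)%N -> (0 < n)%N ->
  (n%:Z = 1 %[mod m%:Z])%Z \/ (n%:Z = -1 %[mod m%:Z])%Z ->
  coprime m n /\ exists s' t,
    [/\ s' = s \/ s' = (m - s)%N, (t < n)%N & (n * s' = s + m * t)%N].
Proof.
move=> s0 sm n0 [/eqP|/eqP]; rewrite eqz_mod_dvd.
  rewrite -[1]/(1%:Z) subzn // => /dvdnP[k nk].
  have nE : n = (k * m + 1)%N by lia.
  split; first by rewrite nE /coprime gcdnMDl gcdn1.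
  exists s, (s * k)%N; split; [by left| |by rewrite nE; ring].
  by rewrite nE addn1 ltnS mulnC leq_mul2l (ltnW sm) orbT.
rewrite opprK -[1]/(1%:Z) -PoszD => /dvdnP[k nk0].
have nk : (n + 1 = k * m)%N by [].
have k0 : (0 < k)%N by case: (k) nk => //; rewrite mul0n addn1.
have sk : (s * k < n.+1)%N.
  by rewrite -[n.+1]addn1 nk [(k * m)%N]mulnC ltn_pmul2r.
split.
  rewrite /coprime -dvdn1 -(@dvdn_addr n) ?dvdn_gcdr //.
  by rewrite nk dvdn_mull // dvdn_gcdl.
exists (m - s)%N, (n - s * k)%N; split; first by right.
  by rewrite ltn_subrL muln_gt0 s0 k0.
rewrite !mulnBr; move: nk sk sm; rewrite ltnS => nk sk sm.
have : (m * (s * k) = n * s + s)%N.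
  by rewrite mulnCA -[(m * k)%N]mulnC -nk; ring.
have : (n * s <= n * m)%N by rewrite leq_mul2l (ltnW sm) orbT.
have : (m * (s * k) <= m * n)%N by rewrite leq_mul2l sk orbT.
by rewrite [(n * m)%N]mulnC; lia.
Qed.

Theorem theorem1 (m s n r : nat)
  (hs : (0 < s)%N) (hsm : (s < m)%N)
  (hn1 : (1 < n)%N) (hnodd : odd n)
  (hnm : (n%:Z = 1 %[mod m%:Z])%Z \/ (n%:Z = -1 %[mod m%:Z])%Z)
  (hr : (2 <= r)%N) :
  rf_congr
    (\sum_(0 <= k < n ^ r)
       2%:R * qfact (q ^+ s) (q ^+ m) k * qfact (q ^+ (m - s)) (q ^+ m) k
         * q ^+ (m * k)
       / (qfact (q ^+ m) (q ^+ m) k ^+ 2 * (1 + q ^+ (m * k))))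
    ((-1) ^+ least_residue (- s%:R / m%:R) n *
     \sum_(0 <= k < n ^ r.-1)
       2%:R * qfact (q ^+ (s * n)) (q ^+ (m * n)) k
         * qfact (q ^+ (m * n - s * n)) (q ^+ (m * n)) k
         * q ^+ (m * n * k)
       / (qfact (q ^+ (m * n)) (q ^+ (m * n)) k ^+ 2 * (1 + q ^+ (m * n * k))))
    (\prod_(1 <= j < r.+1) 'Phi_(n ^ j) ^+ 2).
Proof.
have r0 := ltnW hr; have m0 := leq_ltn_trans (leq0n s) hsm.
have [co [s' [t [s'E tn tE]]]] := shifted_residue hs hsm (ltnW hn1) hnm.
rewrite (least_residueE m0 co tn tE).
rewrite (phi_sum_qE _ (subnKC (ltnW hsm))).
rewrite (phi_sum_qE _ (subnKC (leq_mul (ltnW hsm) (leqnn n)))).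
have <- : phi_sum (q ^+ (m * n)) (n ^ r.-1) (q ^+ (s' * n))
        = phi_sum (q ^+ (m * n)) (n ^ r.-1) (q ^+ (s * n)).
  case: s'E => -> //; rewrite -[RHS]phi_sumC ?expf_neq0 ?q_neq0 //.
  congr (phi_sum _ _ _).
  rewrite mulnBl -{2}(subnK (leq_mul (ltnW hsm) (leqnn n))) exprD mulfK //.
  by rewrite expf_neq0 // q_neq0.
have [||W HW [V E]] := difference_quotient hn1 hnodd co _ _ tn tE r0.
- by case: s'E => ->; rewrite ?subn_gt0.
- by case: s'E => ->; rewrite // ltn_subrL hs.
have PE : \prod_(1 <= j < r.+1) 'Phi_(n ^ j) ^+ 2
    = cycpart n r (fun=> 2%N) by [].
apply: (rf_congr_coprime _ _ _ E); first exact: avoids_neq0 HW.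
- by rewrite PE cycpart_monic.
- by rewrite PE coprime_avoids.
Qed.
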